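(* Let $b\ge1$. For general $b\times b$ matrices $B_1,B_2$ over $k$, write $E_{p,q}(B)$ for the block matrix whose $(p,q)$ block is $B$ and all of whose other blocks are zero. Define the representation $N_1$ of the $4$-arrow Kronecker quiver $K_4$, of dimension $(6b,4b)$ (matrices with $6\times4$ blocks), by $$\begin{aligned}N_1(a_1)&=-E_{1,2}(B_1)+E_{2,3}(B_1)+E_{4,4}(B_1),\\ N_1(a_2)&=E_{1,1}(B_1)-E_{3,3}(B_1)-E_{5,4}(B_1),\\ N_1(a_3)&=-E_{2,1}(B_1)+E_{3,2}(B_1)+E_{6,4}(B_1),\\ N_1(a_4)&=-E_{4,1}(B_1)+E_{5,2}(B_1)-E_{6,3}(B_1),\end{aligned}$$ and the representation $N_2$ of $K_4$, of dimension $(10b,4b)$ (matrices with $10\times4$ blocks), by $$\begin{aligned}N_2(a_1)&=E_{1,2}(B_2)+E_{2,3}(B_2)+E_{4,4}(B_2)+E_{7,1}(B_2),\\ N_2(a_2)&=E_{1,1}(B_2)+E_{3,3}(B_2)+E_{5,4}(B_2)+E_{8,2}(B_2),\\ N_2(a_3)&=E_{2,1}(B_2)+E_{3,2}(B_2)+E_{6,4}(B_2)+E_{9,3}(B_2),\\ N_2(a_4)&=E_{4,1}(B_2)+E_{5,2}(B_2)+E_{6,3}(B_2)+E_{10,4}(B_2).\end{aligned}$$ Then, for every $a\ge1$, $c_{N_1}$ is a semi-invariant function for the tensors of size $2a\times5a\times4$, and $c_{N_2}$ is a semi-invariant function for the tensors of size $2a\times3a\times4$.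
   Context: $k$ is a field of characteristic $0$. $K_n$ is the quiver with vertices $1,2$ and $n$ arrows $a_1,\dots,a_n$ from $1$ to $2$. Vectors are row vectors, so a representation $M$ of $K_n$ of dimension $(\alpha_1,\alpha_2)$ is an $n$-tuple of $\alpha_1\times\alpha_2$ matrices $M(a_i)$, acting by right multiplication on row vectors. The space $\mathrm{Rep}_\alpha(K_n)$ is identified with the space of tensors $U^*\otimes V\otimes W^*$ of size $\alpha_1\times\alpha_2\times n$, $\dim(U,V,W)=(\alpha_1,\alpha_2,n)$, where $W$ is the span of the arrows. $\mathrm{GL}_\alpha=\mathrm{GL}_{\alpha_1}\times\mathrm{GL}_{\alpha_2}$ acts by base change and $G=\mathrm{GL}(W)=\mathrm{GL}_n$ acts through its natural action on the span of arrows, $(gM)(a)=M(g^{-1}a)$ ($M$ extended linearly to the span of arrows). A semi-invariant function for the tensors of size $\alpha_1\times\alpha_2\times n$ is a function $f\in k[\mathrm{Rep}_\alpha(K_n)]$ that is semi-invariant for $\mathrm{GL}_\alpha\times G$, i.e. $g\cdot f=\chi(g)f$ for some character $\chi$ (so $f$ is invariant under $\mathrm{SL}(U)\times\mathrm{SL}(V)\times\mathrm{SL}(W)$). Euler form: $\langle\alpha,\beta\rangle=\alpha_1\beta_1+\alpha_2\beta_2-n\alpha_1\beta_2$. For $M,N$ of dimension $\alpha,\beta$ with $\langle\alpha,\beta\rangle=0$, take an injective resolution $0\to N\to I_0\to I_1\to0$ and set $c_N(M)=c(M,N)=\det\big(\mathrm{Hom}(M,I_0)\to\mathrm{Hom}(M,I_1)\big)$,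 well defined up to a nonzero constant; $c_N$ is viewed as a function on $\mathrm{Rep}_\alpha(K_n)$. ''General'' means: in a nonempty Zariski open subset. *)

(* Defs.v *)
From HB Require Import structures.
From mathcomp Require Import all_boot all_order all_algebra.
From mathcomp Require Import mpoly.
From mathcomp Require Import mxtens.
From mathcomp Require Import zify.

Set Implicit Arguments.
Unset Strict Implicit.
Unset Printing Implicit Defensive.

Import GRing.Theory.
Local Open Scope ring_scope.

(* Throughout, vectors are row vectors and a linear map k^m -> k^m' is an
   m x m' matrix acting on the right. *)

Section PolynomialFunctions.
Variable k : fieldType.

(* [x : T -> I -> k] is a system of affine coordinates on [T], indexed by the
   finite type [I]. *)
Definition eval_at (I : finType) (T : Type) (x : T -> I -> k)
    (P : {mpoly k[#|I|]}) (t : T) : k :=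
  P.@[fun i => x t (enum_val i)].

Definition polynomial_fun (I : finType) (T : Type) (x : T -> I -> k)
    (f : T -> k) : Prop :=
  exists P : {mpoly k[#|I|]}, forall t, f t = eval_at x P t.

Definition zariski_open (I : finType) (T : Type) (x : T -> I -> k)
    (U : T -> Prop) : Prop :=
  exists S : {mpoly k[#|I|]} -> Prop,
    forall t, U t <-> exists2 P, S P & eval_at x P t != 0.

Definition for_general (I : finType) (T : Type) (x : T -> I -> k)
    (Q : T -> Prop) : Prop :=
  exists U : T -> Prop,
    [/\ zariski_open x U, exists t, U t & forall t, U t -> Q t].

Definition mx2_coord (p q r s : nat) (t : 'M[k]_(p, q) * 'M[k]_(r, s))
    (i : 'I_p * 'I_q + 'I_r * 'I_s) : k :=
  match i with
  | inl ij => t.1 ij.1 ij.2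
  | inr ij => t.2 ij.1 ij.2
  end.

End PolynomialFunctions.

Section KroneckerQuiver.
Variables (k : fieldType) (n : nat).

Definition rep (p q : nat) : Type := 'I_n -> 'M[k]_(p, q).

Definition rep_coord p q (M : rep p q) (i : 'I_n * ('I_p * 'I_q)) : k :=
  M i.1 i.2.1 i.2.2.

Definition euler_form (p q p' q' : nat) : int :=
  (p * p')%:Z + (q * q')%:Z - (n * (p * q'))%:Z.

Definition is_rep_hom p q p' q' (M : rep p q) (N : rep p' q')
    (phi1 : 'M[k]_(p, p')) (phi2 : 'M[k]_(q, q')) : Prop :=
  forall a, M a *m phi2 = phi1 *m N a.

(* The injective representation E_1^p (+) E_2^q, where E_x is the injective
   envelope of the simple at the vertex x: at vertex 1 it is
   k^p (+) (k^q)^n, at vertex 2 it is k^q, and the arrow a_j maps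
   (x, (y_1, ..., y_n)) to y_j. Every injective representation is isomorphic
   to one of these. *)
Definition inj_rep (p q : nat) : rep (p + n * q) q :=
  fun a => col_mx 0 (lin1_mx (fun y : 'rV[k]_(n * q) => row a (vec_mx y))).

(* The morphism M -> E_1^p (+) E_2^q attached to u : M_1 -> k^p and
   v : M_2 -> k^q under Hom(M, E_1^p (+) E_2^q) = Hom(M_1, k^p) (+)
   Hom(M_2, k^q): it is [hom_inj1 M u v] at vertex 1 and [v] at vertex 2. *)
Definition hom_inj1 r s p q (M : rep r s)
    (u : 'M[k]_(r, p)) (v : 'M[k]_(s, q)) : 'M[k]_(r, p + n * q) :=
  row_mx u (\matrix_(i < r) mxvec (\matrix_(j < n, c < q) (M j *m v) i c)).

(* The matrix of Hom(M, E_1^p0 (+) E_2^q0) -> Hom(M, E_1^p1 (+) E_2^q1),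
   composition with (d1, d2), in the bases given by [hom_inj1]. *)
Definition hom_map_mx r s p0 q0 p1 q1 (M : rep r s)
    (d1 : 'M[k]_(p0 + n * q0, p1 + n * q1)) (d2 : 'M[k]_(q0, q1)) :
    'M[k]_(r * p0 + s * q0, r * p1 + s * q1) :=
  lin1_mx (fun w : 'rV[k]_(r * p0 + s * q0) =>
    let u := vec_mx (lsubmx w) in
    let v := vec_mx (rsubmx w) in
    row_mx (mxvec (lsubmx (hom_inj1 M u v *m d1))) (mxvec (v *m d2))).

(* 0 -> N -> E_1^p0 (+) E_2^q0 -> E_1^p1 (+) E_2^q1 -> 0 is exact *)
Record is_inj_resolution p' q' (N : rep p' q') p0 q0 p1 q1
    (i1 : 'M[k]_(p', p0 + n * q0)) (i2 : 'M[k]_(q', q0))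
    (d1 : 'M[k]_(p0 + n * q0, p1 + n * q1)) (d2 : 'M[k]_(q0, q1)) : Prop :=
  IsInjResolution {
    res_hom_i : is_rep_hom N (@inj_rep p0 q0) i1 i2;
    res_hom_d : is_rep_hom (@inj_rep p0 q0) (@inj_rep p1 q1) d1 d2;
    res_mono : row_free i1 /\ row_free i2;
    res_exact : (i1 == kermx d1)%MS /\ (i2 == kermx d2)%MS;
    res_epi : row_full d1 /\ row_full d2
  }.

(* [is_c N f]: f is (a nonzero multiple of) the function c_N on
   Rep_(r, s)(K_n), computed from some injective resolution of N. The equality
   [e] says that the two Hom spaces have the same dimension; it holds exactly
   when the Euler form vanishes (see [inj_resolution_hom_dim]). *)
Definition is_c r s p' q' (N : rep p' q') (f : rep r s -> k) : Prop :=
  exists p0 q0 p1 q1 i1 i2 d1 d2,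
    @is_inj_resolution p' q' N p0 q0 p1 q1 i1 i2 d1 d2 /\
  exists (e : (r * p1 + s * q1 = r * p0 + s * q0)%N) (c : k),
    c != 0 /\
    forall M, f M = c * \det (castmx (erefl, e) (hom_map_mx M d1 d2)).

(* (g1, g2) in GL_p x GL_q acts by base change and g3 in GL_n by
   (g3 M)(a) = M(g3^-1 a), where g3 a_j = \sum_i (g3)_ij a_i. *)
Definition gl_act p q (g1 : 'M[k]_p) (g2 : 'M[k]_q) (g3 : 'M[k]_n)
    (M : rep p q) : rep p q :=
  fun j => g1 *m (\sum_(i < n) (invmx g3) i j *: M i) *m invmx g2.

Definition mx3_coord p q (g : 'M[k]_p * 'M[k]_q * 'M[k]_n)
    (i : 'I_p * 'I_p + 'I_q * 'I_q + 'I_n * 'I_n) : k :=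
  match i with
  | inl (inl ij) => g.1.1 ij.1 ij.2
  | inl (inr ij) => g.1.2 ij.1 ij.2
  | inr ij => g.2 ij.1 ij.2
  end.

(* Characters of the algebraic group GL_p x GL_q x GL_n; a regular function on
   this group is a polynomial in the entries divided by a power of the product
   of the determinants. The values of chi outside the group are irrelevant. *)
Record is_character p q (chi : 'M[k]_p -> 'M[k]_q -> 'M[k]_n -> k) : Prop :=
  IsCharacter {
    character1 : chi 1%:M 1%:M 1%:M = 1;
    characterM : forall g1 g2 g3 h1 h2 h3,
      g1 \in unitmx -> g2 \in unitmx -> g3 \in unitmx ->
      h1 \in unitmx -> h2 \in unitmx -> h3 \in unitmx ->
      chi (g1 *m h1) (g2 *m h2) (g3 *m h3) = chi g1 g2 g3 * chi h1 h2 h3;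
    character_regular : exists (P : {mpoly k[_]}) (m : nat),
      forall g1 g2 g3,
        g1 \in unitmx -> g2 \in unitmx -> g3 \in unitmx ->
        chi g1 g2 g3 =
          eval_at (@mx3_coord p q) P (g1, g2, g3)
          / (\det g1 * \det g2 * \det g3) ^+ m
  }.

(* (g . f)(M) = f(g^-1 M) *)
Definition semi_invariant p q (f : rep p q -> k) : Prop :=
  polynomial_fun (@rep_coord p q) f /\
  exists2 chi, @is_character p q chi &
    forall g1 g2 g3, g1 \in unitmx -> g2 \in unitmx -> g3 \in unitmx ->
    forall M, f (gl_act (invmx g1) (invmx g2) (invmx g3) M)
              = chi g1 g2 g3 * f M.

End KroneckerQuiver.

Arguments is_c {k n} r s {p' q'} N f.

Section SanityChecks.
Variables (k : fieldType) (n : nat).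

Let row_matrixK r q (u : 'I_r -> 'rV[k]_q) i : row i (\matrix_(j < r) u j) = u i.
Proof. by apply/rowP => c; rewrite !mxE. Qed.

Lemma mul_inj_rep r p q (x : 'M[k]_(r, p)) (y : 'M[k]_(r, n * q)) a :
  row_mx x y *m inj_rep k p q a = \matrix_(i < r) row a (vec_mx (row i y)).
Proof.
rewrite mul_row_col mulmx0 add0r; apply/row_matrixP => i.
rewrite row_mul.
rewrite row_matrixK.
have lin : linear (fun z : 'rV[k]_(n * q) => row a (vec_mx z)).
  by move=> c u v; rewrite !linearP.
pose aux := GRing.isLinear.Build _ _ _ _ _ lin.
pose L : {linear 'rV[k]_(n * q) -> 'rV[k]_q} := HB.pack (fun z => row a (vec_mx z)) aux.
exact: (mul_rV_lin1 L).
Qed.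

Lemma hom_inj1_is_hom r s p q (M : rep k n r s) u v :
  is_rep_hom M (@inj_rep k n p q) (hom_inj1 M u v) v.
Proof.
move=> a; rewrite mul_inj_rep; apply/row_matrixP => i.
by rewrite !row_matrixK mxvecK; apply/rowP => c; rewrite !mxE.
Qed.

Lemma is_hom_inj1 r s p q (M : rep k n r s) phi1 (v : 'M[k]_(s, q)) :
  is_rep_hom M (@inj_rep k n p q) phi1 v -> phi1 = hom_inj1 M (lsubmx phi1) v.
Proof.
move=> h; rewrite -{1}[phi1]hsubmxK; congr row_mx.
apply/row_matrixP => i; rewrite row_matrixK; apply: (can_inj vec_mxK).
rewrite mxvecK; apply/matrixP => j c.
by rewrite [RHS]mxE h -{2}[phi1]hsubmxK mul_inj_rep !mxE.
Qed.

Lemma inj_rep_injective p q r s r' s' (X : rep k n r s) (Y : rep k n r' s')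
    m1 m2 (phi1 : 'M[k]_(r, p + n * q)) (phi2 : 'M[k]_(s, q)) :
  is_rep_hom X Y m1 m2 -> row_free m1 -> row_free m2 ->
  is_rep_hom X (@inj_rep k n p q) phi1 phi2 ->
  exists psi1 psi2, [/\ is_rep_hom Y (@inj_rep k n p q) psi1 psi2,
    m1 *m psi1 = phi1 & m2 *m psi2 = phi2].
Proof.
move=> hm f1 f2 hphi.
exists (hom_inj1 Y (pinvmx m1 *m lsubmx phi1) (pinvmx m2 *m phi2)).
exists (pinvmx m2 *m phi2).
have e2 : m2 *m (pinvmx m2 *m phi2) = phi2.
  by rewrite mulmxA mulmxVp // mul1mx.
split=> //; first exact: hom_inj1_is_hom.
set u := _ *m lsubmx _; set v := _ *m phi2.
have hc : is_rep_hom X (@inj_rep k n p q) (m1 *m hom_inj1 Y u v) phi2.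
  by move=> a; rewrite -mulmxA -hom_inj1_is_hom mulmxA -hm -mulmxA e2.
rewrite (is_hom_inj1 hc) (is_hom_inj1 hphi); congr hom_inj1.
by rewrite mul_mx_row row_mxKl /u mulmxA mulmxVp // mul1mx.
Qed.

Lemma inj_resolution_hom_dim r s p' q' (N : rep k n p' q')
    p0 q0 p1 q1 i1 i2 d1 d2 :
  @is_inj_resolution k n p' q' N p0 q0 p1 q1 i1 i2 d1 d2 ->
  (r * p1 + s * q1 = r * p0 + s * q0)%N <-> euler_form n r s p' q' = 0.
Proof.
case=> _ _ [/eqP f1 /eqP f2] [/eqmxP e1 /eqmxP e2] [/eqP g1 /eqP g2].
have h1 : (p' + (p1 + n * q1) = p0 + n * q0)%N.
  by have := rank_leq_row d1; rewrite g1 -f1 e1 mxrank_ker g1 => /subnK.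
have h2 : (q' + q1 = q0)%N.
  by have := rank_leq_row d2; rewrite g2 -f2 e2 mxrank_ker g2 => /subnK.
rewrite /euler_form; split; nia.
Qed.

(* The standard resolution, with injectives E_1^p' (+) E_2^q' and
   E_1^(n q'). *)
Lemma inj_resolution_exists p' q' (N : rep k n p' q') :
  exists p0 q0 p1 q1 i1 i2 d1 d2,
    @is_inj_resolution k n p' q' N p0 q0 p1 q1 i1 i2 d1 d2.
Proof.
pose i1 := hom_inj1 N (1%:M : 'M_p') (1%:M : 'M_q').
pose D : 'M[k]_(p' + n * q', n * q') := col_mx (- rsubmx i1) 1%:M.
pose d1 : 'M[k]_(p' + n * q', n * q' + n * 0) := row_mx D 0.
exists p', q', (n * q')%N, 0%N, i1, 1%:M, d1, 0.
have f1 : row_free i1.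
  by apply/row_freeP; exists (col_mx 1%:M 0); rewrite mul_row_col mul1mx mulmx0 addr0.
have D_full : \rank D = (n * q')%N.
  apply/eqP; rewrite -[_ == _]/(row_full D); apply/row_fullP.
  by exists (row_mx 0 1%:M); rewrite mul_row_col mul0mx mul1mx add0r.
have d1_full : row_full d1.
  have eD : D = d1 *m col_mx 1%:M 0 by rewrite mul_row_col mulmx1 mulmx0 addr0.
  have := mxrankM_maxl d1 (col_mx 1%:M 0).
  rewrite -eD D_full /row_full eqn_leq rank_leq_col /=; lia.
have id1 : i1 *m d1 = 0.
  rewrite mul_mx_row mulmx0 -{1}[i1]hsubmxK mul_row_col /i1 /hom_inj1 row_mxKl.
  by rewrite mul1mx mulmx1 addNr row_mx0.
split.
- exact: hom_inj1_is_hom.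
- by move=> a; rewrite !thinmx0.
- by split=> //; rewrite row_free_unit unitmx1.
- split; last by rewrite submx1 andbT; apply/sub_kermxP; rewrite mulmx0.
  have le : (i1 <= kermx d1)%MS by apply/sub_kermxP.
  rewrite -(geq_leqif (mxrank_leqif_eq le)) mxrank_ker.
  by rewrite (eqP f1) (eqP d1_full); lia.
- by split=> //; rewrite /row_full -leqn0 rank_leq_col.
Qed.

Lemma is_c_exists r s p' q' (N : rep k n p' q') :
  euler_form n r s p' q' = 0 -> exists f, is_c r s N f.
Proof.
have [p0 [q0 [p1 [q1 [i1 [i2 [d1 [d2 res]]]]]]]] := inj_resolution_exists N.
move=> /(inj_resolution_hom_dim r s res) e.
exists (fun M => 1 * \det (castmx (erefl, e) (hom_map_mx M d1 d2))).
exists p0, q0, p1, q1, i1, i2, d1, d2; split=> //.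
by exists e, 1; split=> //; exact: oner_neq0.
Qed.

End SanityChecks.

Section TheRepresentations.
Variable k : fieldType.

(* The matrix with r x s blocks of size b x b whose (p, q) block, numbered from
   1, is B and whose other blocks are zero. *)
Definition blk (r s b p q : nat) (B : 'M[k]_b) : 'M[k]_(r * b, s * b) :=
  (\matrix_(i < r, j < s) ((i.+1 == p) && (j.+1 == q))%:R) *t B.

Definition N1 (b : nat) (B : 'M[k]_b) : rep k 4 (6 * b) (4 * b) :=
  let E p q := blk 6 4 p q B in
  tnth [tuple
    - E 1 2 + E 2 3 + E 4 4;
    E 1 1 - E 3 3 - E 5 4;
    - E 2 1 + E 3 2 + E 6 4;
    - E 4 1 + E 5 2 - E 6 3].

Definition N2 (b : nat) (B : 'M[k]_b) : rep k 4 (10 * b) (4 * b) :=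
  let E p q := blk 10 4 p q B in
  tnth [tuple
    E 1 2 + E 2 3 + E 4 4 + E 7 1;
    E 1 1 + E 3 3 + E 5 4 + E 8 2;
    E 2 1 + E 3 2 + E 6 4 + E 9 3;
    E 4 1 + E 5 2 + E 6 3 + E 10 4].

End TheRepresentations.

(* Main.v *)
From HB Require Import structures.
Require Import Defs.
From Stdlib Require Import Classical_Prop.
From mathcomp Require Import all_boot all_order all_algebra.
From mathcomp Require Import mpoly.
From mathcomp Require Import mxtens zify ring.

(* Up to a constant, c_N(M) is the determinant of the map
     Hom(M_1, N_1) (+) Hom(M_2, N_2) -> (+)_a Hom(M_1, N_2),
     (u, v) |-> (M(a) v - u N(a))_a,
   whatever injective resolution 0 -> N -> I_0 -> I_1 -> 0 is used: both are
   compared with the determinant of the map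
     Hom(M_1, I_0,1) (+) Hom(M_2, I_0,2) ->
       (+)_a Hom(M_1, I_0,2) (+) Hom(M, I_1),
   which becomes block triangular in two ways, by the splitting
   Hom(M_1, I_1) (+) Hom(M_2, I_2) = Hom(M, I) (+) (+)_a Hom(M_1, I_2) for I
   injective, and by the splittings of the resolution at each vertex.
   The determinant above is visibly semi-invariant for GL_alpha, and for GL(W) as
   soon as g N is isomorphic to N for every g in GL(W). This holds for N_1 and N_2,
   the tensor products with B_1 and B_2 of the inclusions of the skew, resp.
   symmetric, tensors in W (x) W. *)

Set Implicit Arguments.
Unset Strict Implicit.
Unset Printing Implicit Defensive.

Import GRing.Theory VectorInternalTheory.
Local Open Scope ring_scope.

(** * Determinants of linear maps *)

Section LinearDeterminant.
Variable k : fieldType.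

Lemma dim_pair (U V : vectType k) : dim (U * V)%type = (dim U + dim V)%N.
Proof. by []. Qed.

Lemma dim_ffun n (U : vectType k) : dim {ffun 'I_n -> U} = (n * dim U)%N.
Proof. by rewrite -[RHS]/(n * dim U)%N -[X in _ = (X * _)%N](card_ord n). Qed.

Definition dimE := (dim_pair, dim_ffun, dim_matrix).

(* The determinant of a square matrix whose two dimensions need not be
   convertible; the value is 0 when they differ. *)
Definition cdet m m' (X : 'M[k]_(m, m')) : k :=
  if m == m' then \det (conform_mx (0 : 'M_m) X) else 0.

Lemma cdet_sq m (X : 'M[k]_m) : cdet X = \det X.
Proof. by rewrite /cdet eqxx conform_mx_id. Qed.

Lemma cdet_castmx m m' (e : m' = m) (X : 'M[k]_(m, m')) :
  \det (castmx (erefl, e) X) = cdet X.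
Proof. by case: m / e X => X; rewrite castmx_id cdet_sq. Qed.

(** If the last dimension differs from the other two, both sides are 0 by the convention for
    [cdet]. *)
Lemma cdet_mul m m' m'' (X : 'M[k]_(m, m')) (Y : 'M[k]_(m', m'')) :
  m = m' -> cdet (X *m Y) = cdet X * cdet Y.
Proof.
move=> e; case: m' / e X Y => X Y; rewrite cdet_sq.
have [e|ne] := eqVneq m m''.
  by case: m'' / e Y => Y; rewrite !cdet_sq det_mulmx.
by rewrite /cdet (negPf ne) mulr0.
Qed.

Lemma cdet_ublock m1 m2 n1 n2 (X : 'M[k]_(m1, n1)) Z (Y : 'M[k]_(m2, n2)) :
  m1 = n1 -> cdet (block_mx X Z 0 Y) = cdet X * cdet Y.
Proof.
move=> e; case: n1 / e X Z => X Z; rewrite cdet_sq.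
have [e|ne] := eqVneq m2 n2.
  by case: n2 / e Y Z => Y Z; rewrite !cdet_sq det_ublock.
by rewrite /cdet eqn_add2l (negPf ne) mulr0.
Qed.

Lemma cdet_lblock m1 m2 n1 n2 (X : 'M[k]_(m1, n1)) Z (Y : 'M[k]_(m2, n2)) :
  m1 = n1 -> cdet (block_mx X 0 Z Y) = cdet X * cdet Y.
Proof.
move=> e; case: n1 / e X Z => X Z; rewrite cdet_sq.
have [e|ne] := eqVneq m2 n2.
  by case: n2 / e Y Z => Y Z; rewrite !cdet_sq det_lblock.
by rewrite /cdet eqn_add2l (negPf ne) mulr0.
Qed.

Lemma mulmx_ext m n (A B : 'M[k]_(m, n)) :
  (forall w : 'rV_m, w *m A = w *m B) -> A = B.
Proof. by move=> e; apply/row_matrixP => i; rewrite !rowE. Qed.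

(** The map is a bare function, with linearity a separate hypothesis where it is used, so that maps
    given by formulas need no bundled linear structure. *)
Definition fun_mx (U V : vectType k) (f : U -> V) : 'M[k]_(dim U, dim V) :=
  lin1_mx (v2r \o f \o r2v).

Definition ldet (U V : vectType k) (f : U -> V) : k := cdet (fun_mx f).

Lemma mul_lin1_mx m n (f : 'rV[k]_m -> 'rV[k]_n) u :
  linear f -> u *m lin1_mx f = f u.
Proof.
move=> lf; pose aux := GRing.isLinear.Build _ _ _ _ _ lf.
pose L : {linear 'rV[k]_m -> 'rV[k]_n} := HB.pack f aux.
exact: (mul_rV_lin1 L).
Qed.

Lemma mul_fun_mx (U V : vectType k) (f : U -> V) w :
  linear f -> w *m fun_mx f = v2r (f (r2v w)).
Proof.
by move=> lf; rewrite mul_lin1_mx // => c x y; rewrite /= linearP lf linearP.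
Qed.

Lemma eq_ldet (U V : vectType k) (f g : U -> V) : f =1 g -> ldet f = ldet g.
Proof.
move=> e; congr cdet; apply/matrixP => i j.
by rewrite !mxE /= e.
Qed.

Lemma fun_mx_comp (U V W : vectType k) (f : U -> V) (g : V -> W) :
  linear f -> linear g -> fun_mx (g \o f) = fun_mx f *m fun_mx g.
Proof.
move=> lf lg; apply: mulmx_ext => w; rewrite mulmxA !mul_fun_mx //.
  by rewrite v2rK.
by move=> c x y /=; rewrite lf lg.
Qed.

Lemma ldet_comp (U V W : vectType k) (f : U -> V) (g : V -> W) :
  linear f -> linear g -> dim U = dim V -> ldet (g \o f) = ldet f * ldet g.
Proof. by move=> lf lg d; rewrite /ldet fun_mx_comp // cdet_mul. Qed.

Lemma ldet_id (U : vectType k) (f : U -> U) : f =1 id -> ldet f = 1.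
Proof.
move/eq_ldet->; rewrite /ldet cdet_sq -(det1 _ (dim U)); congr (\det _).
by apply: mulmx_ext => w; rewrite mul_fun_mx // r2vK mulmx1.
Qed.

Lemma ldet_cancel (U V : vectType k) (f : U -> V) (g : V -> U) :
  linear f -> linear g -> dim U = dim V -> cancel f g -> ldet f * ldet g = 1.
Proof. by move=> lf lg d fK; rewrite -ldet_comp // ldet_id. Qed.

(* The coordinates [v2r] chosen on a product need not be the concatenation of
   the coordinates of the factors; [pair_mx] is the change of coordinates. *)
Definition pair_mx (U V : vectType k) : 'M[k]_(dim U + dim V) :=
  lin1_mx (fun w : 'rV[k]_(dim U + dim V) =>
    v2r ((r2v (lsubmx w), r2v (rsubmx w)) : U * V)).

Lemma mul_pair_mx (U V : vectType k) x y :
  row_mx x y *m pair_mx U V = v2r ((r2v x, r2v y) : U * V).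
Proof.
rewrite mul_lin1_mx ?row_mxKl ?row_mxKr // => c u v.
by rewrite -linearP; congr v2r; rewrite !linearP.
Qed.

Lemma pair_mx_unit (U V : vectType k) : pair_mx U V \in unitmx.
Proof.
rewrite -row_free_unit; apply/row_freeP.
exists (lin1_mx (fun w : 'rV[k]_(dim U + dim V) =>
  row_mx (v2r (r2v w : U * V).1) (v2r (r2v w : U * V).2))).
apply: mulmx_ext => w; rewrite mulmx1 mulmxA.
rewrite -[w]hsubmxK mul_pair_mx mul_lin1_mx.
  by rewrite !v2rK !r2vK.
by move=> c u v; rewrite !linearP scale_row_mx add_row_mx.
Qed.

Definition pair_det (U V : vectType k) : k := \det (pair_mx U V).

Lemma pair_det_neq0 (U V : vectType k) : pair_det U V != 0.
Proof. by have := pair_mx_unit U V; rewrite unitmxE unitfE. Qed.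

(** In the coordinates of [pair_mx] the matrix is block triangular; with row vectors, [z] sits in
    the lower left block. The two [pair_det] factors account for the change of coordinates. *)
Lemma ldet_upper (U1 U2 V1 V2 : vectType k) (f : U1 * U2 -> V1 * V2)
    (a : U1 -> V1) (z : U2 -> V1) (b : U2 -> V2) :
  linear a -> linear z -> linear b ->
  dim U1 = dim V1 -> dim U2 = dim V2 ->
  (forall u, f u = (a u.1 + z u.2, b u.2)) ->
  pair_det U1 U2 * ldet f = ldet a * ldet b * pair_det V1 V2.
Proof.
move=> la lz lb d1 d2 fE.
have lf : linear f.
  by move=> c x y; rewrite !fE /= la lz lb; congr (_, _) => /=; rewrite scalerDr addrACA.
have e : pair_mx U1 U2 *m fun_mx f =
    block_mx (fun_mx a) 0 (fun_mx z) (fun_mx b) *m pair_mx V1 V2.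
  apply: mulmx_ext => w; rewrite !mulmxA -[w]hsubmxK.
  set x := lsubmx _; set y := rsubmx _.
  rewrite mul_pair_mx mul_row_block mulmx0 add0r !mul_fun_mx // mul_pair_mx v2rK.
  by rewrite -linearD /= !v2rK fE.
rewrite /pair_det /ldet -!cdet_sq -cdet_mul // e cdet_mul ?cdet_lblock //.
by rewrite d1 d2.
Qed.

Lemma ldet_lower (U1 U2 V1 V2 : vectType k) (f : U1 * U2 -> V1 * V2)
    (a : U1 -> V1) (z : U1 -> V2) (b : U2 -> V2) :
  linear a -> linear z -> linear b ->
  dim U1 = dim V1 -> dim U2 = dim V2 ->
  (forall u, f u = (a u.1, z u.1 + b u.2)) ->
  pair_det U1 U2 * ldet f = ldet a * ldet b * pair_det V1 V2.
Proof.
move=> la lz lb d1 d2 fE.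
have lf : linear f.
  by move=> c x y; rewrite !fE /= la lz lb; congr (_, _) => /=; rewrite scalerDr addrACA.
have e : pair_mx U1 U2 *m fun_mx f =
    block_mx (fun_mx a) (fun_mx z) 0 (fun_mx b) *m pair_mx V1 V2.
  apply: mulmx_ext => w; rewrite !mulmxA -[w]hsubmxK.
  set x := lsubmx _; set y := rsubmx _.
  rewrite mul_pair_mx mul_row_block mulmx0 addr0 !mul_fun_mx // mul_pair_mx v2rK.
  by rewrite -linearD /= !v2rK fE.
rewrite /pair_det /ldet -!cdet_sq -cdet_mul // e cdet_mul ?cdet_ublock //.
by rewrite d1 d2.
Qed.

Lemma ldet_unipotent (U V : vectType k) (f : U * V -> U * V) (z : V -> U) :
  linear z -> (forall u, f u = (u.1 + z u.2, u.2)) -> ldet f = 1.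
Proof.
move=> lz fE; apply: (mulfI (pair_det_neq0 U V)).
rewrite (ldet_upper (a := id) (z := z) (b := id)) //.
by rewrite !(ldet_id (f := id)) // !mul1r mulr1.
Qed.

End LinearDeterminant.

(** * Comparison of c_N with the determinant of the Hom complex *)

Section HomComplex.
Variables (k : fieldType) (n : nat).

(** The differential of the two-term complex with kernel Hom(M, X) and cokernel Ext^1(M, X). *)
Definition delta r s x y (M : rep k n r s) (X : rep k n x y)
    (w : 'M[k]_(r, x) * 'M[k]_(s, y)) : {ffun 'I_n -> 'M[k]_(r, y)} :=
  [ffun a => M a *m w.2 - w.1 *m X a].

Lemma delta_linear r s x y (M : rep k n r s) (X : rep k n x y) :
  linear (delta M X).
Proof.
move=> c u v; apply/ffunP => a; rewrite !ffunE /= mulmxDl mulmxDr.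
by rewrite -scalemxAl -scalemxAr scalerBr opprD addrACA.
Qed.

Variables r s : nat.

(* For injective I the first component of [delta_top] is onto with kernel
   Hom(M, I), and the second one restricts to the coordinates of [hom_inj1] on
   that kernel. *)
Definition delta_top p q (M : rep k n r s)
    (w : 'M[k]_(r, p + n * q) * 'M[k]_(s, q)) :
    {ffun 'I_n -> 'M[k]_(r, q)} * ('M[k]_(r, p) * 'M[k]_(s, q)) :=
  (delta M (@inj_rep k n p q) w, (lsubmx w.1, w.2)).

Lemma delta_top_linear p q (M : rep k n r s) : linear (@delta_top p q M).
Proof. by move=> c u v; rewrite /delta_top delta_linear /= linearP. Qed.

Definition pack_arrows q (c : {ffun 'I_n -> 'M[k]_(r, q)}) : 'M[k]_(r, n * q) :=
  \matrix_(i < r) mxvec (\matrix_(j < n, l < q) c j i l).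

Lemma pack_arrows_linear q : linear (@pack_arrows q).
Proof.
move=> c u v; apply/row_matrixP => i; rewrite linearP !rowK; apply: (can_inj vec_mxK).
by rewrite linearP !mxvecK; apply/matrixP => j l; rewrite !mxE !mxvecE !ffunE !mxE.
Qed.

Lemma hom_inj1_linear p q (M : rep k n r s) :
  linear (fun h : 'M[k]_(r, p) * 'M[k]_(s, q) => hom_inj1 M h.1 h.2).
Proof.
move=> c u v; rewrite /hom_inj1 /= scale_row_mx add_row_mx; congr row_mx.
apply/row_matrixP => i; rewrite linearP !rowK; apply: (can_inj vec_mxK).
rewrite linearP !mxvecK; apply/matrixP => j l.
by rewrite [LHS]mxE mulmxDr -scalemxAr !mxE !mxvecE !mxE.
Qed.

(** [hom_inj1] supplies the kernel part and [pack_arrows] a lift of the arrow component; the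
    subtraction offsets the minus sign in [delta]. *)
Definition delta_top_inv p q (M : rep k n r s)
    (ch : {ffun 'I_n -> 'M[k]_(r, q)} * ('M[k]_(r, p) * 'M[k]_(s, q))) :
    'M[k]_(r, p + n * q) * 'M[k]_(s, q) :=
  (hom_inj1 M ch.2.1 ch.2.2 - row_mx 0 (pack_arrows ch.1), ch.2.2).

Lemma delta_top_inv_linear p q (M : rep k n r s) :
  linear (@delta_top_inv p q M).
Proof.
move=> c [c1 h1] [c2 h2]; congr (_, _).
rewrite [LHS]/= (hom_inj1_linear M c h1 h2) pack_arrows_linear /=.
rewrite -{1}(addr0 (0 : 'M_(r, p))) -{1}(scaler0 _ c) -add_row_mx -scale_row_mx.
by rewrite opprD scalerBr addrACA.
Qed.

Lemma delta_top_invK p q (M : rep k n r s) :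
  cancel (@delta_top_inv p q M) (@delta_top p q M).
Proof.
case=> c [u v]; rewrite /delta_top /delta_top_inv /=; congr (_, (_, _)); last first.
  by rewrite linearB /= /hom_inj1 !row_mxKl subr0.
apply/ffunP => a; rewrite ffunE /= mulmxBl -hom_inj1_is_hom opprB addrCA subrr addr0.
rewrite mul_inj_rep; apply/matrixP => i l.
by rewrite !mxE mxvecE mxE.
Qed.

(** [M] enters only through the shear that adds M(a) v to the arrow component, and this shear is
    unipotent. *)
Lemma ldet_delta_top p q (M : rep k n r s) :
  ldet (@delta_top p q M) = ldet (@delta_top p q (fun=> 0)).
Proof.
pose z (h : 'M[k]_(r, p) * 'M[k]_(s, q)) : {ffun 'I_n -> 'M[k]_(r, q)} :=
  [ffun a => M a *m h.2].
have lz : linear z.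
  by move=> c u v; apply/ffunP => a; rewrite !ffunE /= mulmxDr scalemxAr.
pose U (ch : {ffun 'I_n -> 'M[k]_(r, q)} * ('M[k]_(r, p) * 'M[k]_(s, q))) :=
  (ch.1 + z ch.2, ch.2).
have lU : linear U.
  by move=> c u v; congr (_, _) => /=; rewrite lz scalerDr addrACA.
have U1 : ldet U = 1 by apply: (ldet_unipotent lz).
rewrite -[RHS]mulr1 -U1 -ldet_comp //; last 2 first.
- exact: delta_top_linear.
- rewrite !dimE; lia.
apply: eq_ldet => w; congr (_, _); apply/ffunP => a.
by rewrite !ffunE /= mul0mx sub0r addrC.
Qed.

Lemma split_exact a b c (i : 'M[k]_(a, b)) (d : 'M[k]_(b, c)) :
  row_free i -> (i == kermx d)%MS -> row_full d ->
  (a + c = b)%N /\ exists rho sigma,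
    [/\ i *m rho = 1%:M, sigma *m d = 1%:M, sigma *m rho = 0 & i *m d = 0].
Proof.
move=> fi /eqmxP ex fd; split.
  have /eqP := fi; rewrite ex mxrank_ker (eqP fd) => <-.
  by rewrite subnK // -(eqP fd) rank_leq_row.
have id0 : i *m d = 0 by apply/sub_kermxP; rewrite ex.
have [rho irho] := row_freeP fi; have [sg sgd] := row_fullP fd.
(* The section [sg] is corrected by its component along [i]: its composite with [rho] becomes 0 and
   its composite with [d] stays the identity. *)
exists rho, (sg *m (1%:M - rho *m i)); split=> //.
  by rewrite mulmxBr mulmx1 mulmxBl sgd -!mulmxA id0 !mulmx0 subr0.
by rewrite -mulmxA mulmxBl mul1mx -mulmxA irho mulmx1 subrr mulmx0.
Qed.

(** * Comparison for a fixed injective resolution of N *)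

Section Resolution.
Variables (p' q' : nat) (N : rep k n p' q') (p0 q0 p1 q1 : nat).
Variables (i1 : 'M[k]_(p', p0 + n * q0)) (i2 : 'M[k]_(q', q0)).
Variables (d1 : 'M[k]_(p0 + n * q0, p1 + n * q1)) (d2 : 'M[k]_(q0, q1)).
Hypothesis res : is_inj_resolution N i1 i2 d1 d2.
Hypothesis e : (r * p1 + s * q1 = r * p0 + s * q0)%N.

Definition hom_map (M : rep k n r s) (w : 'M[k]_(r, p0) * 'M[k]_(s, q0)) :
    'M[k]_(r, p1) * 'M[k]_(s, q1) :=
  (lsubmx (hom_inj1 M w.1 w.2 *m d1), w.2 *m d2).

Lemma hom_map_linear M : linear (hom_map M).
Proof.
move=> c u v; congr (_, _) => /=; last by rewrite mulmxDl -scalemxAl.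
by rewrite (hom_inj1_linear M c u v) mulmxDl -scalemxAl linearP.
Qed.

Lemma cdet_hom_map_mx :
  exists x, forall M, cdet (hom_map_mx M d1 d2) = x * ldet (hom_map M).
Proof.
pose io (w : 'rV[k]_(r * p0 + s * q0)) : 'M[k]_(r, p0) * 'M[k]_(s, q0) :=
  (vec_mx (lsubmx w), vec_mx (rsubmx w)).
pose ip (h : 'M[k]_(r, p1) * 'M[k]_(s, q1)) : 'rV[k]_(r * p1 + s * q1) :=
  row_mx (mxvec h.1) (mxvec h.2).
have lio : linear io by move=> c u v; rewrite /io !linearP.
have lip : linear ip.
  by move=> c u v; rewrite /ip /= !linearP scale_row_mx add_row_mx.
have lo : linear (v2r \o io) by move=> c u v; rewrite /= lio linearP.
have lp : linear (ip \o r2v) by move=> c u v; rewrite /= linearP lip.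
exists (cdet (lin1_mx (v2r \o io)) * cdet (lin1_mx (ip \o r2v))) => M.
have lh := hom_map_linear M.
have lH : linear (ip \o hom_map M \o io).
  by move=> c u v; rewrite /= lio lh lip.
have -> : hom_map_mx M d1 d2 =
    lin1_mx (v2r \o io) *m fun_mx (hom_map M) *m lin1_mx (ip \o r2v).
  apply: mulmx_ext => w; rewrite !mulmxA mul_lin1_mx // mul_fun_mx //.
  by rewrite !mul_lin1_mx //= !v2rK.
by rewrite !cdet_mul ?dimE // mulrAC.
Qed.

(* The map compared with both sides in [ldet_hom_map] and [ldet_mixed_map]: the
   first component of [delta_top] for I_0, and the coordinates of the image in
   Hom(M, I_1). *)
Definition mixed_map (M : rep k n r s)
    (w : 'M[k]_(r, p0 + n * q0) * 'M[k]_(s, q0)) :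
    {ffun 'I_n -> 'M[k]_(r, q0)} * ('M[k]_(r, p1) * 'M[k]_(s, q1)) :=
  (delta M (@inj_rep k n p0 q0) w, (lsubmx (w.1 *m d1), w.2 *m d2)).

Lemma mixed_map_linear M : linear (mixed_map M).
Proof.
move=> c u v; rewrite /mixed_map delta_linear /=.
by rewrite !mulmxDl -!scalemxAl linearP.
Qed.

(** Precomposing [mixed_map] with the inverse of [delta_top] gives a block triangular map with
    diagonal blocks the identity and [hom_map]; the determinant of that inverse is independent of
    [M]. *)
Lemma ldet_hom_map : exists x, forall M, ldet (hom_map M) = x * ldet (mixed_map M).
Proof.
set C := ({ffun 'I_n -> 'M[k]_(r, q0)})%type.
set X := ('M[k]_(r, p0) * 'M[k]_(s, q0))%type.
set Y := ('M[k]_(r, p1) * 'M[k]_(s, q1))%type.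
pose z (c : C) : Y := (lsubmx (- row_mx 0 (pack_arrows c) *m d1), 0).
have lz : linear z.
  move=> t u v; congr (_, _); last by rewrite /= scaler0 addr0.
  rewrite /= pack_arrows_linear -linearP scalemxAl; congr lsubmx.
  rewrite -mulmxDl -{1}(addr0 (0 : 'M_(r, p0))) -{1}(scaler0 _ t).
  by rewrite -add_row_mx -scale_row_mx opprD scalerN.
exists ((ldet (@delta_top p0 q0 (fun=> 0)))^-1 * pair_det C X / pair_det C Y).
move=> M.
have lA := @delta_top_linear p0 q0 M.
have lA' := @delta_top_inv_linear p0 q0 M.
have dC : dim (C * X)%type = dim ('M[k]_(r, p0 + n * q0) * 'M[k]_(s, q0))%type.
  by rewrite !dimE; lia.
have AA := ldet_cancel lA' lA dC (@delta_top_invK p0 q0 M).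
have eA : ldet (@delta_top_inv p0 q0 M) =
    (ldet (@delta_top p0 q0 (fun=> 0)))^-1.
  by rewrite -(ldet_delta_top p0 q0 M) -(mulr1_eq AA) invrK.
have lP := mixed_map_linear M.
have := ldet_lower (f := mixed_map M \o delta_top_inv M) (a := id) (z := z) (b := hom_map M).
rewrite ldet_comp // eA (ldet_id (f := id)) // mul1r => E.
apply: (mulIf (pair_det_neq0 C Y)); rewrite -E //.
- by rewrite [RHS]mulrAC divfK ?pair_det_neq0 // mulrA (mulrC (pair_det C X)).
- exact: hom_map_linear.
case=> c h; congr (_, _).
  by have := delta_top_invK M (c, h) => -[].
by congr (_, _); rewrite /= ?add0r // mulmxDl linearD addrC.
Qed.

(** Splitting I_0 as N plus I_1 at each vertex makes [mixed_map] block triangular, with diagonal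
    blocks [delta M N] and [delta_top] for I_1; the determinant of the latter is independent of
    [M]. *)
Lemma ldet_mixed_map : exists x, forall M, ldet (mixed_map M) = x * ldet (delta M N).
Proof.
case: res => hi hd [fi1 fi2] [ex1 ex2] [fd1 fd2].
have [dim1 [rho1 [sg1 [ir1 sd1 sr1 id1]]]] := split_exact fi1 ex1 fd1.
have [dim2 [rho2 [sg2 [ir2 sd2 sr2 id2]]]] := split_exact fi2 ex2 fd2.
set C0 := ('M[k]_(r, p0 + n * q0) * 'M[k]_(s, q0))%type.
set CN := ('M[k]_(r, p') * 'M[k]_(s, q'))%type.
set C1 := ('M[k]_(r, p1 + n * q1) * 'M[k]_(s, q1))%type.
set D0 := ({ffun 'I_n -> 'M[k]_(r, q0)})%type.
set DN := ({ffun 'I_n -> 'M[k]_(r, q')})%type.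
set D1 := ({ffun 'I_n -> 'M[k]_(r, q1)})%type.
set Y := ('M[k]_(r, p1) * 'M[k]_(s, q1))%type.
(* [S0] and [S1] split the source and the arrow part of the target along the resolution; [S0'] and
   [S1'] are their inverses. *)
pose S0 (w : C0) : CN * C1 := ((w.1 *m rho1, w.2 *m rho2), (w.1 *m d1, w.2 *m d2)).
pose S0' (w : CN * C1) : C0 :=
  (w.1.1 *m i1 + w.2.1 *m sg1, w.1.2 *m i2 + w.2.2 *m sg2).
pose S1 (w : D0 * Y) : DN * (D1 * Y) :=
  ([ffun a => w.1 a *m rho2], ([ffun a => w.1 a *m d2], w.2)).
pose S1' (w : DN * (D1 * Y)) : D0 * Y :=
  ([ffun a => w.1 a *m i2 + w.2.1 a *m sg2], w.2.2).
have lS0 : linear S0.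
  by move=> c u v; rewrite /S0 /= !mulmxDl -!scalemxAl.
have lS0' : linear S0'.
  move=> c u v; rewrite /S0' /= !mulmxDl -!scalemxAl.
  by congr (_, _); rewrite /= scalerDr addrACA.
have lS1 : linear S1.
  move=> c u v; congr (_, (_, _));
  by apply/ffunP => a; rewrite !ffunE /= mulmxDl -scalemxAl.
have lS1' : linear S1'.
  move=> c u v; congr (_, _); apply/ffunP => a; rewrite !ffunE /=.
  by rewrite !mulmxDl -!scalemxAl scalerDr addrACA.
have dS0 : dim (CN * C1)%type = dim C0 by rewrite !dimE; nia.
have dS1 : dim (DN * (D1 * Y))%type = dim (D0 * Y)%type by rewrite !dimE; nia.
have S0K : cancel S0' S0.
  case=> [[n1 n2] [t1 t2]]; rewrite /S0 /S0' /= !mulmxDl -!mulmxA.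
  by rewrite ir1 ir2 sd1 sd2 sr1 sr2 id1 id2 !mulmx0 !mulmx1 !addr0 !add0r.
have S1K : cancel S1' S1.
  case=> [c [c1 h]]; congr (_, (_, _)); apply/ffunP => a; rewrite !ffunE /=.
    by rewrite mulmxDl -!mulmxA ir2 sr2 mulmx0 mulmx1 addr0.
  by rewrite mulmxDl -!mulmxA id2 sd2 mulmx0 mulmx1 add0r.
have KS0 := ldet_cancel lS0' lS0 dS0 S0K.
have KS1 := ldet_cancel lS1' lS1 dS1 S1K.
exists (ldet S0 * ldet S1' * (pair_det CN C1)^-1
  * ldet (@delta_top p1 q1 (fun=> 0)) * pair_det DN (D1 * Y)%type) => M.
pose tau (t : C1) : C0 := (t.1 *m sg1, t.2 *m sg2).
have ltau : linear tau by move=> c u v; rewrite /tau /= !mulmxDl -!scalemxAl.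
(* The off-diagonal block: the N-component of [delta] on the lift [tau t]. It is nonzero in general,
   because the sections at the two vertices need not form a morphism of representations. *)
pose z (t : C1) : DN :=
  [ffun a => delta M (@inj_rep k n p0 q0) (tau t) a *m rho2].
have lz : linear z.
  move=> c u v; apply/ffunP => a; rewrite /z ltau delta_linear.
  move: (delta _ _ (tau u)) (delta _ _ (tau v)) => f g.
  by rewrite !ffunE mulmxDl -scalemxAl.
have lP := mixed_map_linear M.
have lC : linear (mixed_map M \o S0') by move=> c u v; rewrite /= lS0' lP.
have FE w : (S1 \o (mixed_map M \o S0')) w = (delta M N w.1 + z w.2, delta_top M w.2).
  have := S0K w; rewrite /S0.
  case: w => m t; set w := S0' _ => -[_ td].
  have td1 : t.1 = w.1 *m d1 by rewrite -td.
  have td2 : t.2 = w.2 *m d2 by rewrite -td.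
  (* [delta] commutes with postcomposition by morphisms of representations: here [(d1, d2)], and
     below [(i1, i2)]. *)
  have deltaD2 a : delta M (@inj_rep k n p0 q0) w a *m d2 =
      delta M (@inj_rep k n p1 q1) t a.
    by rewrite !ffunE td1 td2 mulmxBl -!mulmxA hd.
  have deltaR2 a : delta M (@inj_rep k n p0 q0) w a *m rho2 =
      delta M N m a + z t a.
    pose em : C0 := (m.1 *m i1, m.2 *m i2).
    have dem : delta M (@inj_rep k n p0 q0) em a = delta M N m a *m i2.
      by rewrite !ffunE mulmxBl -!mulmxA hi.
    have -> : w = 1 *: em + tau t by rewrite scale1r.
    rewrite delta_linear scale1r [X in X *m rho2]ffunE mulmxDl dem -mulmxA.
    by rewrite ir2 mulmx1 [z t a]ffunE.
  rewrite /= /S1 /=; congr (_, (_, (_, _))).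
  - by apply/ffunP => a; rewrite ffunE deltaR2 [RHS]ffunE.
  - by apply/ffunP => a; rewrite ffunE deltaD2.
  - by rewrite [in RHS]td1.
  - exact: esym td2.
(* Exactness at both vertices turns [e] into the vanishing of the Euler form of M and N. *)
have dN : dim CN = dim DN by rewrite !dimE; nia.
have dT : dim C1 = dim (D1 * Y)%type by rewrite !dimE; nia.
have := ldet_upper (delta_linear M N) lz (@delta_top_linear p1 q1 M) dN dT FE.
rewrite (ldet_delta_top p1 q1 M) !ldet_comp //; last by rewrite !dimE; nia.
move=> E.
transitivity (ldet S0 * ldet S1' * (pair_det CN C1)^-1 * (pair_det CN C1 *
    (ldet S0' * ldet (mixed_map M) * ldet S1))); last first.
  by rewrite E; ring.
rewrite -!mulrA mulKf ?pair_det_neq0 //.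
transitivity (ldet S0' * ldet S0 * (ldet S1' * ldet S1) * ldet (mixed_map M)); last by ring.
by rewrite KS0 KS1 !mul1r.
Qed.

Lemma cdet_hom_delta : exists x, forall M : rep k n r s,
  cdet (hom_map_mx M d1 d2) = x * ldet (delta M N).
Proof.
have [x xE] := cdet_hom_map_mx; have [y yE] := ldet_hom_map.
have [z zE] := ldet_mixed_map; exists (x * y * z) => M.
by rewrite xE yE zE !mulrA.
Qed.

End Resolution.

End HomComplex.

(** * Invariance under base change *)

Section Equivariance.
Variables (k : fieldType) (n : nat).

(** The pair [(h1, h2)] is an isomorphism to [N] from its twist by [g] on the arrows. *)
Definition arrow_equivariant p q (N : rep k n p q) : Prop :=
  forall g : 'M[k]_n, g \in unitmx ->
  exists h1 h2, [/\ h1 \in unitmx, h2 \in unitmx &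
    forall j, h1 *m N j = (\sum_i g i j *: N i) *m h2].

Lemma is_c_delta r s p q (N : rep k n p q) f : is_c r s N f ->
  (r * p + s * q = n * (r * q))%N /\
  exists x, forall M : rep k n r s, f M = x * ldet (delta M N).
Proof.
case=> p0 [q0 [p1 [q1 [i1 [i2 [d1 [d2 [res [e [c [_ fE]]]]]]]]]]]; split.
  have [_ _ [fi1 fi2] [ex1 ex2] [fd1 fd2]] := res.
  have [dim1 _] := split_exact fi1 ex1 fd1.
  have [dim2 _] := split_exact fi2 ex2 fd2.
  nia.
have [x xE] := cdet_hom_delta res e.
by exists (c * x) => M; rewrite fE cdet_castmx xE mulrA.
Qed.

(** Automorphisms [T0] and [T1] of the source and target of [delta] carry the map for [M] to the map
    for the transformed representation, so the factor comes from their determinants. *)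
Lemma is_c_gl_act r s p q (N : rep k n p q) (f : rep k n r s -> k) g1 g2 g3 :
  arrow_equivariant N -> is_c r s N f ->
  g1 \in unitmx -> g2 \in unitmx -> g3 \in unitmx ->
  exists x, forall M, f (gl_act g1 g2 g3 M) = x * f M.
Proof.
move=> eqN /is_c_delta [dimN [x fE]] u1 u2 u3.
(* [gl_act] acts on the arrows through the inverse of [g3], so the equivariance of [N] is taken at
   that inverse. *)
have [|h1 [h2 [v1 v2 hN]]] := eqN (invmx g3); first by rewrite unitmx_inv.
set C := ('M[k]_(r, p) * 'M[k]_(s, q))%type.
pose T0 (w : C) : C := (g1 *m w.1 *m h1, g2 *m w.2 *m h2).
pose T0' (w : C) : C := (invmx g1 *m w.1 *m invmx h1, invmx g2 *m w.2 *m invmx h2).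
pose T1 (c : {ffun 'I_n -> 'M[k]_(r, q)}) : {ffun 'I_n -> 'M[k]_(r, q)} :=
  [ffun j => g1 *m (\sum_i (invmx g3) i j *: c i) *m h2].
have lT a b c d : linear (fun w : C => (a *m w.1 *m b, c *m w.2 *m d) : C).
  move=> t u v; congr (_, _);
  by rewrite /= mulmxDr mulmxDl -scalemxAr -scalemxAl.
have lT1 : linear T1.
  move=> t u v; apply/ffunP => j; rewrite !ffunE scalemxAl scalemxAr.
  rewrite -mulmxDl -mulmxDr scaler_sumr -big_split; congr (_ *m _ *m _).
  apply: eq_bigr => i _; rewrite /= !ffunE scalerDr !scalerA; congr (_ *: _ + _).
  exact: mulrC.
have K : ldet T0 * ldet T0' = 1.
  apply: ldet_cancel => //; try exact: lT.
  case=> u v; rewrite /T0' /T0 /= !mulmxA !mulVmx // !mul1mx.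
  by rewrite -!mulmxA !mulmxV // !mulmx1.
exists (ldet T0' * ldet T1) => M; rewrite !fE.
have E : delta (gl_act g1 g2 g3 M) N \o T0 =1 T1 \o delta M N.
  case=> u v; apply/ffunP => j; rewrite /T1 /= !ffunE /= /gl_act.
  rewrite -!mulmxA (mulmxA (invmx g2)) mulVmx // mul1mx hN.
  rewrite -mulmxBr; congr (_ *m _); rewrite !mulmxA -mulmxBl; congr (_ *m _).
  rewrite mulmx_suml mulmx_sumr -sumrB; apply: eq_bigr => i _.
  by rewrite ffunE scalerBr scalemxAl scalemxAr.
have := eq_ldet E; rewrite ldet_comp //; [|exact: lT|exact: delta_linear].
rewrite ldet_comp //; [|exact: delta_linear|rewrite !dimE; nia].
move=> E'; transitivity (ldet T0' * (x * (ldet T0 * ldet (delta (gl_act g1 g2 g3 M) N)))).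
  transitivity (ldet T0 * ldet T0' * (x * ldet (delta (gl_act g1 g2 g3 M) N))).
    by rewrite K mul1r.
  ring.
by rewrite E'; ring.
Qed.

End Equivariance.

(** * Polynomial and regular functions *)

Section FunctionAlgebra.
Variables (k : fieldType) (T : Type).

(** Serves both for polynomial functions and for regular functions on the group; closure under
    pointwise equality stands in for function extensionality. *)
Record fun_algebra (S : (T -> k) -> Prop) : Prop := FunAlgebra {
  fa_ext : forall f g, f =1 g -> S f -> S g;
  fa_const : forall c, S (fun=> c);
  fa_add : forall f g, S f -> S g -> S (fun t => f t + g t);
  fa_mul : forall f g, S f -> S g -> S (fun t => f t * g t) }.

Variable S : (T -> k) -> Prop.
Hypothesis hS : fun_algebra S.

Lemma fa_sum (I : Type) (l : seq I) (P : pred I) (F : I -> T -> k) :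
  (forall i, S (F i)) -> S (fun t => \sum_(i <- l | P i) F i t).
Proof.
move=> SF; elim: l => [|i l IH].
  by apply: (fa_ext hS _ (fa_const hS 0)) => t; rewrite big_nil.
case Pi: (P i); last by apply: (fa_ext hS _ IH) => t; rewrite big_cons Pi.
by apply: (fa_ext hS _ (fa_add hS (SF i) IH)) => t; rewrite big_cons Pi.
Qed.

Lemma fa_prod (I : Type) (l : seq I) (P : pred I) (F : I -> T -> k) :
  (forall i, S (F i)) -> S (fun t => \prod_(i <- l | P i) F i t).
Proof.
move=> SF; elim: l => [|i l IH].
  by apply: (fa_ext hS _ (fa_const hS 1)) => t; rewrite big_nil.
case Pi: (P i); last by apply: (fa_ext hS _ IH) => t; rewrite big_cons Pi.
by apply: (fa_ext hS _ (fa_mul hS (SF i) IH)) => t; rewrite big_cons Pi.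
Qed.

Lemma fa_exp f e : S f -> S (fun t => f t ^+ e).
Proof.
move=> Sf; have := fa_prod (index_enum 'I_e) xpredT (fun=> Sf).
by apply: (fa_ext hS) => t; rewrite prodr_const card_ord.
Qed.

Lemma fa_det m (A : T -> 'M[k]_m) :
  (forall i j, S (fun t => A t i j)) -> S (fun t => \det (A t)).
Proof.
move=> SA; rewrite /determinant; apply: fa_sum => s.
by apply: (fa_mul hS); [exact: (fa_const hS) | exact: fa_prod].
Qed.

Lemma fa_mulmx m1 m2 m3 (A : T -> 'M[k]_(m1, m2)) (B : T -> 'M[k]_(m2, m3)) :
  (forall i j, S (fun t => A t i j)) -> (forall i j, S (fun t => B t i j)) ->
  forall i j, S (fun t => (A t *m B t) i j).
Proof.
move=> SA SB i j; have SAB l := fa_mul hS (SA i l) (SB l j).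
by apply: (fa_ext hS _ (fa_sum (index_enum _) xpredT SAB)) => t; rewrite !mxE.
Qed.

Lemma fa_meval n (P : {mpoly k[n]}) (v : T -> 'I_n -> k) :
  (forall i, S (fun t => v t i)) -> S (fun t => P.@[v t]).
Proof.
move=> Sv.
apply: (fa_ext hS (f := fun t => \sum_(m <- msupp P) P@_m * \prod_i v t i ^+ m i)).
  by move=> t; rewrite mevalE.
apply: fa_sum => m; apply: (fa_mul hS); first exact: (fa_const hS).
by apply: fa_prod => i; apply: fa_exp.
Qed.

End FunctionAlgebra.

Lemma polynomial_fun_algebra (k : fieldType) (I : finType) T (x : T -> I -> k) :
  fun_algebra (polynomial_fun x).
Proof.
split=> [f g e [P fE]|c|f g [P fE] [Q gE]|f g [P fE] [Q gE]].
- by exists P => t; rewrite -e.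
- by exists c%:MP => t; rewrite /eval_at mevalC.
- by exists (P + Q) => t; rewrite /eval_at mevalD fE gE.
- by exists (P * Q) => t; rewrite /eval_at mevalM fE gE.
Qed.

Lemma polynomial_fun_coord (k : fieldType) (I : finType) T (x : T -> I -> k) i :
  polynomial_fun x (fun t => x t i).
Proof.
by exists 'X_(enum_rank i) => t; rewrite /eval_at mevalXU enum_rankK.
Qed.

Section RegularFunctions.
Variables (k : fieldType) (n p q : nat).

Let G := ('M[k]_p * 'M[k]_q * 'M[k]_n)%type.

Definition unit_triple (g : G) : bool :=
  [&& g.1.1 \in unitmx, g.1.2 \in unitmx & g.2 \in unitmx].

Definition det_triple (g : G) : k := \det g.1.1 * \det g.1.2 * \det g.2.

Lemma det_triple_neq0 g : unit_triple g -> det_triple g != 0.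
Proof. by case/and3P; rewrite !unitmxE !unitfE !mulf_eq0 !negb_or => -> -> ->. Qed.

Definition regular_fun (f : G -> k) : Prop :=
  exists (P : {mpoly k[_]}) (m : nat), forall g, unit_triple g ->
    f g = eval_at (@mx3_coord k n p q) P g / det_triple g ^+ m.

Lemma polynomial_mx3 : [/\
  forall i j, polynomial_fun (@mx3_coord k n p q) (fun g => g.1.1 i j),
  forall i j, polynomial_fun (@mx3_coord k n p q) (fun g => g.1.2 i j) &
  forall i j, polynomial_fun (@mx3_coord k n p q) (fun g => g.2 i j)].
Proof.
split=> i j.
- exact: (polynomial_fun_coord (@mx3_coord k n p q) (inl (inl (i, j)))).
- exact: (polynomial_fun_coord (@mx3_coord k n p q) (inl (inr (i, j)))).
- exact: (polynomial_fun_coord (@mx3_coord k n p q) (inr (i, j))).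
Qed.

Lemma polynomial_det_triple : polynomial_fun (@mx3_coord k n p q) det_triple.
Proof.
have A := polynomial_fun_algebra (@mx3_coord k n p q).
have [P1 P2 P3] := polynomial_mx3.
by do ![apply: (fa_mul A)|apply: (fa_det A)].
Qed.

Lemma regular_fun_polynomial f :
  polynomial_fun (@mx3_coord k n p q) f -> regular_fun f.
Proof. by case=> P fE; exists P, 0%N => g _; rewrite fE expr0 divr1. Qed.

Lemma regular_fun_algebra : fun_algebra regular_fun.
Proof.
have A := polynomial_fun_algebra (@mx3_coord k n p q).
have evalP P : polynomial_fun (@mx3_coord k n p q) (eval_at (@mx3_coord k n p q) P).
  by exists P.
have D m := fa_exp A m polynomial_det_triple.
split=> [f g e [P [m fE]]|c|f g [P [m fE]] [Q [l gE]]|f g [P [m fE]] [Q [l gE]]].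
- by exists P, m => t ut; rewrite -e fE.
- exact: regular_fun_polynomial (fa_const A c).
- have [R RE] :=
    fa_add A (fa_mul A (evalP P) (D l)) (fa_mul A (evalP Q) (D m)).
  exists R, (m + l)%N => t ut; rewrite fE // gE // -RE exprD.
  by rewrite addf_div // expf_neq0 // det_triple_neq0.
- have [R RE] := fa_mul A (evalP P) (evalP Q).
  by exists R, (m + l)%N => t ut; rewrite fE // gE // -RE exprD mulf_div.
Qed.

Lemma regular_fun_invmx i j : regular_fun (fun g => (invmx g.1.1) i j).
Proof.
have A := polynomial_fun_algebra (@mx3_coord k n p q).
have [P1 P2 P3] := polynomial_mx3.
(* The denominator must be a power of the product of all three determinants, so the adjugate entry
   is multiplied by the other two. *)
have : polynomial_fun (@mx3_coord k n p q)
    (fun g => (\adj g.1.1) i j * \det g.1.2 * \det g.2).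
  apply: (fa_mul A); last exact: (fa_det A).
  apply: (fa_mul A); last exact: (fa_det A).
  apply: (fa_ext A (f := fun g => cofactor g.1.1 j i)); first by move=> g; rewrite mxE.
  rewrite /cofactor; apply: (fa_mul A); first exact: (fa_const A).
  apply: (fa_det A) => a b.
  by apply: (fa_ext A _ (P1 (lift j a) (lift i b))) => g; rewrite !mxE.
case=> P PE; exists P, 1%N => g ug; rewrite -PE expr1.
have := det_triple_neq0 ug; rewrite /det_triple !mulf_eq0 !negb_or.
case/andP => /andP[d1 d2] d3.
have /and3P[u1 _ _] := ug; rewrite /invmx u1 mxE.
by field; rewrite d1 d2 d3.
Qed.

End RegularFunctions.

(** * Semi-invariance *)

Section SemiInvariance.
Variables (k : fieldType) (n : nat).

Lemma is_c_polynomial r s p q (N : rep k n p q) (f : rep k n r s -> k) :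
  is_c r s N f -> polynomial_fun (@rep_coord k n r s) f.
Proof.
case=> p0 [q0 [p1 [q1 [i1 [i2 [d1 [d2 [_ [e [c [_ fE]]]]]]]]]]].
have A := polynomial_fun_algebra (@rep_coord k n r s).
apply: (fa_ext A (fun M => esym (fE M))).
apply: (fa_mul A (fa_const A c)); apply: (fa_det A) => i j.
have E M := castmxE (erefl, e) (hom_map_mx M d1 d2) i j.
apply: (fa_ext A (fun M => esym (E M))); move: (cast_ord _ i) (cast_ord _ j).
move=> {E}i {}j.
(* Row [i] of the matrix is the image of the basis vector [w], whose components [u] and [v] do not
   depend on [M]. *)
pose w : 'rV[k]_(r * p0 + s * q0) := delta_mx 0 i.
pose u := vec_mx (lsubmx w); pose v := vec_mx (rsubmx w).
have inj1 a b : polynomial_fun (@rep_coord k n r s) (fun M => hom_inj1 M u v a b).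
  rewrite /hom_inj1; case: (splitP b) => b' eb.
    have -> : b = lshift _ b' by apply: val_inj.
    by apply: (fa_ext A _ (fa_const A (u a b'))) => M; rewrite row_mxEl.
  have -> : b = rshift _ b' by apply: val_inj.
  case/mxvec_indexP: b' {eb} => l d.
  have Mv : polynomial_fun (@rep_coord k n r s) (fun M => (M l *m v) a d).
    apply: (fa_mulmx A) => a' d'; last exact: (fa_const A).
    exact: (polynomial_fun_coord (@rep_coord k n r s) (l, (a', d'))).
  by apply: (fa_ext A _ Mv) => M; rewrite row_mxEr [RHS]mxE mxvecE [RHS]mxE.
rewrite /hom_map_mx; case: (splitP j) => j' ej.
  have -> : j = lshift _ j' by apply: val_inj.
  case/mxvec_indexP: j' {ej} => a b.
  apply: (fa_ext A (f := fun M => (hom_inj1 M u v *m d1) a (lshift _ b))).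
    by move=> M; rewrite [RHS]mxE row_mxEl mxvecE [RHS]mxE.
  by apply: (fa_mulmx A) => // a' b'; exact: (fa_const A).
have -> : j = rshift _ j' by apply: val_inj.
apply: (fa_ext A _ (fa_const A (mxvec (v *m d2) 0 j'))) => M.
by rewrite [RHS]mxE row_mxEr.
Qed.

Lemma invmx_mul m (g h : 'M[k]_m) : g \in unitmx -> h \in unitmx ->
  invmx (g *m h) = invmx h *m invmx g.
Proof.
move=> ug uh; have ugh : g *m h \in unitmx by rewrite unitmx_mul ug.
rewrite -[RHS](mulKmx ugh).
by rewrite -(mulmxA g) (mulmxA h) mulmxV // mul1mx mulmxV // mulmx1.
Qed.

Lemma gl_actM p q (g1 h1 : 'M[k]_p) (g2 h2 : 'M[k]_q) (g3 h3 : 'M[k]_n) M :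
  g2 \in unitmx -> h2 \in unitmx -> g3 \in unitmx -> h3 \in unitmx ->
  gl_act (g1 *m h1) (g2 *m h2) (g3 *m h3) M =1 gl_act g1 g2 g3 (gl_act h1 h2 h3 M).
Proof.
move=> u2 v2 u3 v3 j.
have -> : gl_act g1 g2 g3 (gl_act h1 h2 h3 M) j = g1 *m (h1 *m
    (\sum_l invmx g3 l j *: \sum_i invmx h3 i l *: M i) *m invmx h2) *m invmx g2.
  congr (_ *m _ *m _); rewrite mulmx_sumr mulmx_suml.
  by apply: eq_bigr => l _; rewrite -scalemxAr -scalemxAl.
rewrite /gl_act !invmx_mul // !mulmxA; congr (_ *m _ *m _ *m _ *m _).
under [RHS]eq_bigr do rewrite scaler_sumr.
rewrite exchange_big; apply: eq_bigr => i _ /=.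
under eq_bigr do rewrite scalerA.
rewrite -scaler_suml; congr (_ *: _); rewrite mxE.
by apply: eq_bigr => l _; rewrite mulrC.
Qed.

(* If [f] does not vanish identically, the character is the ratio
   f(g^-1 M0) / f(M0) at any point M0 with f(M0) != 0. *)
Lemma semi_invariant_of_proportional p q (f : rep k n p q -> k) :
  polynomial_fun (@rep_coord k n p q) f ->
  (forall g1 g2 g3, g1 \in unitmx -> g2 \in unitmx -> g3 \in unitmx ->
    exists x, forall M, f (gl_act g1 g2 g3 M) = x * f M) ->
  semi_invariant f.
Proof.
move=> polf ratio; split=> //.
have [[M0 f0]|no] := classic (exists M0, f M0 != 0); last first.
  have f0 M : f M = 0 by apply/eqP; apply/negPn/negP => fM; apply: no; exists M.
  exists (fun _ _ _ => 1) => [|g1 g2 g3 _ _ _ M]; last by rewrite !f0 mulr0.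
  split=> [//|*|]; first by rewrite mulr1.
  by exists 1, 0%N => g1 g2 g3 _ _ _; rewrite expr0 divr1 /eval_at mevalC.
have extf M M' : M =1 M' -> f M = f M'.
  by case: polf => P fE e; rewrite !fE /eval_at; apply: meval_eq => i; rewrite /rep_coord e.
pose chi g1 g2 g3 := f (gl_act (invmx g1) (invmx g2) (invmx g3) M0) / f M0.
have chiE g1 g2 g3 : g1 \in unitmx -> g2 \in unitmx -> g3 \in unitmx ->
    forall M, f (gl_act (invmx g1) (invmx g2) (invmx g3) M) = chi g1 g2 g3 * f M.
  rewrite /chi -(unitmx_inv g1) -(unitmx_inv g2) -(unitmx_inv g3) => u1 u2 u3 M.
  by have [x xE] := ratio _ _ _ u1 u2 u3; rewrite !xE mulfK.
exists chi => //; split.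
- rewrite /chi (extf _ M0) ?divff // => j.
  rewrite /gl_act !invmx1 mul1mx mulmx1 (bigD1 j) //= mxE eqxx scale1r.
  by rewrite big1 ?addr0 // => i ij; rewrite mxE (negPf ij) scale0r.
- move=> g1 g2 g3 h1 h2 h3 u1 u2 u3 v1 v2 v3.
  rewrite {1}/chi !invmx_mul //.
  (* The inverse of gh is h^-1 g^-1, so the value of [chi] at h comes out first and the value at g
     next. *)
  rewrite (extf _ _ (gl_actM _ _ _ _ _ _ _)) ?unitmx_inv // !chiE //.
  by rewrite mulrA mulfK // mulrC.
have A := regular_fun_algebra k n p q.
have [P1 P2 P3] := polynomial_mx3 k n p q.
have [P fE] := polf.
suff [Q [m QE]] : regular_fun (fun g => chi g.1.1 g.1.2 g.2).
  exists Q, m => g1 g2 g3 u1 u2 u3.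
  by apply: (QE (g1, g2, g3)); apply/and3P; split.
apply: (fa_mul A _ (fa_const A _)); apply: (fa_ext A (fun g => esym (fE _))).
(* It remains to see that the entries of the transformed [M0] are regular in g. Only [g1] ends up
   inverted, since [gl_act] inverts [g2] and [g3] back. *)
apply: (fa_meval A) => l; rewrite /rep_coord /gl_act.
move: (enum_val l) => [j [a b]] /=; move: a b.
apply: (fa_mulmx A) => [|a b].
  apply: (fa_mulmx A) => [|a b]; first exact: regular_fun_invmx.
  apply: (fa_ext A (f := fun g => \sum_i g.2 i j * M0 i a b)).
    by move=> g; rewrite invmxK summxE; apply: eq_bigr => i _; rewrite mxE.
  apply: (fa_sum A) => i; apply: (fa_mul A _ (fa_const A _)).
  exact: regular_fun_polynomial.
by apply: (fa_ext A _ (regular_fun_polynomial (P2 a b))) => g; rewrite invmxK.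
Qed.

Lemma is_c_semi_invariant r s p q (N : rep k n p q) (f : rep k n r s -> k) :
  arrow_equivariant N -> is_c r s N f -> semi_invariant f.
Proof.
move=> eqN cf; apply: semi_invariant_of_proportional => [|g1 g2 g3 u1 u2 u3].
  exact: is_c_polynomial cf.
exact: is_c_gl_act eqN cf u1 u2 u3.
Qed.

End SemiInvariance.

(** * Skew and symmetric forms *)

Section BilinearForms.
Variable k : fieldType.

Lemma tens_mx11 m n : (1%:M : 'M[k]_m) *t (1%:M : 'M[k]_n) = 1%:M.
Proof.
apply/matrixP => u v; case: (mxtens_indexP u) => i j; case: (mxtens_indexP v) => l c.
by rewrite tensmxE !mxE (can_eq (@mxtens_indexK m n)) xpair_eqE -natrM mulnb.
Qed.

Lemma tens_mx1_unit m n (A A' : 'M[k]_m) :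
  A *m A' = 1%:M -> A *t (1%:M : 'M[k]_n) \in unitmx.
Proof.
move=> AA.
have [|//] := @mulmx1_unit _ _ (A *t (1%:M : 'M_n)) (A' *t 1%:M).
by rewrite tensmx_mul AA mulmx1 tens_mx11.
Qed.

(* The [alpha x] form a basis of a space of bilinear forms that is stable under
   congruence, and the entries at the places [pos y] are the dual basis. *)
Lemma arrow_equivariant_forms n m b (B : 'M[k]_b) (N : rep k n (m * b) (n * b))
    (S : 'M[k]_n -> Prop) (alpha : 'I_m -> 'M[k]_n) (pos : 'I_m -> 'I_n * 'I_n) :
  (forall j, N j = (\matrix_(x, l) alpha x j l) *t B) ->
  (forall g X, S X -> S (g^T *m X *m g)) ->
  (forall x, S (alpha x)) ->
  (forall X, S X -> X = \sum_y X (pos y).1 (pos y).2 *: alpha y) ->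
  (forall x y, alpha x (pos y).1 (pos y).2 = (x == y)%:R) ->
  arrow_equivariant N.
Proof.
move=> NE Sg Sa SE dual g ug.
(* The matrix of the congruence X |-> g^T X g in the basis [alpha], read off with the dual basis. *)
pose rho g := \matrix_(x, y) (g^T *m alpha x *m g) (pos y).1 (pos y).2.
have rhoE h x : h^T *m alpha x *m h = \sum_y rho h x y *: alpha y.
  rewrite [LHS]SE; last exact: Sg.
  by apply: eq_bigr => y _; congr (_ *: _); rewrite [RHS]mxE.
have rhoV : rho g *m rho (invmx g) = 1%:M.
  apply/matrixP => x z; rewrite mxE.
  transitivity (((invmx g)^T *m (g^T *m alpha x *m g) *m invmx g) (pos z).1 (pos z).2).
    rewrite rhoE mulmx_sumr mulmx_suml summxE; apply: eq_bigr => y _.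
    by rewrite -scalemxAr -scalemxAl [RHS]mxE; congr (_ * _); rewrite [LHS]mxE.
  rewrite -!mulmxA mulmxV // mulmx1 mulmxA -trmx_mul mulmxV // trmx1 mul1mx.
  by rewrite dual mxE.
(* Block rows transform by the congruence and block columns by [g] itself; both leave the factor [B]
   alone. *)
exists (rho g *t 1%:M), (g *t 1%:M); split.
- exact: tens_mx1_unit rhoV.
- exact: tens_mx1_unit (mulmxV ug).
move=> j; rewrite NE tensmx_mul mul1mx.
have -> : \sum_i g i j *: N i =
    (\sum_i g i j *: \matrix_(x, l) alpha x i l) *t B.
  apply/matrixP => u v; rewrite summxE mxE summxE mulr_suml.
  by apply: eq_bigr => i _; rewrite NE !mxE mulrA.
rewrite tensmx_mul mulmx1; congr (_ *t _); apply/matrixP => x l.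
transitivity ((g^T *m alpha x *m g) j l).
  by rewrite rhoE mxE summxE; apply: eq_bigr => y _; rewrite !mxE.
rewrite mulmx_suml summxE -mulmxA mxE; apply: eq_bigr => i _.
rewrite -scalemxAl !mxE; congr (_ * _).
by apply: eq_bigr => c _; rewrite !mxE.
Qed.

(* Indices [p], [q] are numbered from 1. *)
Definition form_mx (e : k) (p q : nat) : 'M[k]_4 := \matrix_(j, l)
  if (j.+1 == p) && (l.+1 == q) then 1
  else if (j.+1 == q) && (l.+1 == p) then e else 0.

(* The position of an entry 1 in each block row of N_1 and N_2; the first six
   serve for both representations. *)
Definition places : seq (nat * nat) :=
  [:: (2, 1); (1, 3); (3, 2); (1, 4); (4, 2); (3, 4);
      (1, 1); (2, 2); (3, 3); (4, 4)].

Definition place (y : nat) : 'I_4 * 'I_4 :=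
  let pq := nth (0, 0)%N places y in (inord pq.1.-1, inord pq.2.-1).

Definition basis_form e (y : nat) : 'M[k]_4 :=
  let pq := nth (0, 0)%N places y in form_mx e pq.1 pq.2.

(** Block row [x], collected over the four arrows, is a bilinear form whose row index is the arrow;
    the blocks are compared one by one. *)
Lemma N1E b (B : 'M[k]_b) j :
  N1 B j = (\matrix_(x < 6, l < 4) basis_form (-1) x j l) *t B.
Proof.
apply/matrixP => u v; case: (mxtens_indexP u) => x y; case: (mxtens_indexP v) => l c.
rewrite tensmxE /N1 (tnth_nth 0).
case: j => [[|[|[|[|//]]]] ?]; rewrite /= !mxE !mxtens_indexK /=;
case: x => [[|[|[|[|[|[|//]]]]]] ?]; case: l => [[|[|[|[|//]]]] ?];
by rewrite /= ?mul0r ?mul1r ?oppr0 ?addr0 ?add0r ?mulN1r.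
Qed.

Lemma N2E b (B : 'M[k]_b) j :
  N2 B j = (\matrix_(x < 10, l < 4) basis_form 1 x j l) *t B.
Proof.
apply/matrixP => u v; case: (mxtens_indexP u) => x y; case: (mxtens_indexP v) => l c.
rewrite tensmxE /N2 (tnth_nth 0).
case: j => [[|[|[|[|//]]]] ?]; rewrite /= !mxE !mxtens_indexK /=;
case: x => [[|[|[|[|[|[|[|[|[|[|//]]]]]]]]]] ?]; case: l => [[|[|[|[|//]]]] ?];
by rewrite /= ?mul0r ?mul1r ?addr0 ?add0r.
Qed.

Lemma congruence_tr e n (g X : 'M[k]_n) :
  X^T = e *: X -> (g^T *m X *m g)^T = e *: (g^T *m X *m g).
Proof. by move=> tX; rewrite !trmx_mul trmxK tX -scalemxAl -scalemxAr mulmxA. Qed.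

(** Transposition fixes a diagonal entry, so p = q is compatible only with e = 1. *)
Lemma form_mx_tr e p q : e * e = 1 -> (p == q) ==> (e == 1) ->
  (form_mx e p q)^T = e *: form_mx e p q.
Proof.
move=> ee pq; apply/matrixP => j l; rewrite !mxE ![(l.+1 == _) && _]andbC.
case: (boolP (_ && (_ == p))) => [/andP[/eqP jq /eqP lp]|_]; case: ifP => c.
- have pq' : p == q by case/andP: c => /eqP <- _; rewrite jq.
  by rewrite (eqP (implyP pq pq')) mulr1.
- by rewrite ee.
- by rewrite mulr1.
- by rewrite mulr0.
Qed.

Lemma arrow_equivariant_N1 b (B : 'M[k]_b) : (2%:R : k) != 0 ->
  arrow_equivariant (N1 B).
Proof.
move=> two0.
apply: (arrow_equivariant_forms (S := fun X => X^T = -1 *: X)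
  (alpha := fun y => basis_form (-1) y) (pos := fun y => place y) (N1E B)).
- by move=> g X; exact: congruence_tr.
- by move=> [[|[|[|[|[|[|//]]]]]] ?]; apply: form_mx_tr => //; rewrite mulrNN mulr1.
- move=> X tX; have skew j l : X l j = - X j l.
    by have /matrixP/(_ j l) := tX; rewrite !mxE mulN1r.
  (* A skew matrix has zero diagonal because 2 is nonzero, so the six off-diagonal places determine
     it. *)
  have diag j : X j j = 0.
    have : X j j *+ 2 = 0 by rewrite mulr2n {1}skew addNr.
    by rewrite -mulr_natr => /eqP; rewrite mulf_eq0 (negPf two0) orbF => /eqP.
  apply/matrixP => j l; rewrite summxE !big_ord_recl big_ord0 !mxE /=.
  rewrite -(inord_val j) -(inord_val l).
  case: j => [[|[|[|[|//]]]] ?]; case: l => [[|[|[|[|//]]]] ?];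
  by rewrite /= ?inordK //= ?mulr0 ?add0r ?addr0 ?mulr1 ?mulrN1 ?diag // -?skew.
- move=> [[|[|[|[|[|[|//]]]]]] ?] [[|[|[|[|[|[|//]]]]]] ?];
  by rewrite mxE /= !inordK.
Qed.

Lemma arrow_equivariant_N2 b (B : 'M[k]_b) : arrow_equivariant (N2 B).
Proof.
apply: (arrow_equivariant_forms (S := fun X => X^T = 1 *: X)
  (alpha := fun y => basis_form 1 y) (pos := fun y => place y) (N2E B)).
- by move=> g X; exact: congruence_tr.
- by move=> y; apply: form_mx_tr; rewrite ?mulr1 ?eqxx ?implybT.
- move=> X tX; have sym j l : X l j = X j l.
    by have /matrixP/(_ j l) := tX; rewrite !mxE mul1r.
  apply/matrixP => j l; rewrite summxE !big_ord_recl big_ord0 !mxE /=.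
  rewrite -(inord_val j) -(inord_val l).
  case: j => [[|[|[|[|//]]]] ?]; case: l => [[|[|[|[|//]]]] ?];
  by rewrite /= ?inordK //= ?mulr0 ?add0r ?addr0 ?mulr1.
- move=> [[|[|[|[|[|[|[|[|[|[|//]]]]]]]]]] ?] [[|[|[|[|[|[|[|[|[|[|//]]]]]]]]]] ?];
  by rewrite mxE /= !inordK.
Qed.

End BilinearForms.

Theorem proposition4p3 (k : fieldType) (char0 : [pchar k] =i pred0)
    (b : nat) (hb : (1 <= b)%N) :
  for_general (@mx2_coord k b b b b)
    (fun B : 'M[k]_b * 'M[k]_b =>
      forall a : nat, (1 <= a)%N ->
        (forall f, is_c (2 * a) (5 * a) (N1 B.1) f -> semi_invariant f) /\
        (forall f, is_c (2 * a) (3 * a) (N2 B.2) f -> semi_invariant f)).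
Proof.
have two0 : (2%:R : k) != 0 by rewrite ((pcharf0P k).1 char0).
(* The open set is the whole space, the nonvanishing locus of the constant polynomial 1; the pair of
   zero matrices shows that it is nonempty. *)
exists (fun=> True); split=> //.
- exists (fun P => P = 1) => t; split=> // _; exists 1 => //.
  by rewrite /eval_at meval1 oner_eq0.
- by exists (0, 0).
move=> B _ a _; split=> f; apply: is_c_semi_invariant.
  exact: arrow_equivariant_N1.
exact: arrow_equivariant_N2.
Qed.
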